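(* For all $u\in\mathcal{D}$, we have $$\text{(I)}\quad \delta(u)-(\mu_2-\mu_1)\,d_2(u,\mathcal{M}_1)^2\ge(\mu_3-\mu_2)\,d_2(u,\mathcal{M}_2)^2$$ and $$\text{(II)}\quad \delta(u)-\left(1-\frac{\mu_1}{\mu_2}\right)d_{\mathcal{E}}(u,\mathcal{M}_1)^2\ge\mu_1\left(\frac{1}{\mu_2}-\frac{1}{\mu_3}\right)d_{\mathcal{E}}(u,\mathcal{M}_2)^2.$$ The constants $\mu_3-\mu_2$ and $\mu_1\left(\frac{1}{\mu_2}-\frac{1}{\mu_3}\right)$ are sharp (cannot be replaced by larger constants) and can be attained (equality holds for some $u$ with nonzero distance to $\mathcal{M}_2$), and equality holds in (I), respectively in (II), if and only if $u\in\mathcal{M}_3$. The remainders (left-hand side minus right-hand side) in (I) and (II) are respectively $$\sum_{k\ge4}(\mu_k-\mu_3)\|u_k\|_2^2\qquad\text{and}\qquad\frac{\mu_1}{\mu_3}\sum_{k\ge4}(\mu_k-\mu_3)\|u_k\|_2^2.$$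
   Context: $\mu$ is a finite positive measure on a set $X$ and $A\ge0$ is a self-adjoint operator on $L^2(\mu)$ with compact resolvent. Its distinct eigenvalues are $0=\mu_0<\mu_1<\mu_2<\cdots$ with $\mu_k\to\infty$; $E_k$ is the (finite-dimensional) eigenspace of $\mu_k$, and $E_0$ is assumed to be the space of constant functions. $\mathcal{E}(u)=\langle Au,u\rangle$ is the associated quadratic form, defined on its form domain $\mathcal{D}$. $\|\cdot\|_2$ is the norm of $L^2(\mu)$. For $u\in\mathcal{D}$, $\bar u$ is the orthogonal projection of $u$ onto $E_0$, $\operatorname{Var}_\mu(u)=\|u-\bar u\|_2^2$, and $u-\bar u=\sum_{k\ge1}u_k$ with $u_k\in E_k$ the orthogonal projection of $u$ onto $E_k$. Set $$\delta(u)=\mathcal{E}(u)-\mu_1\operatorname{Var}_\mu(u),\qquad \mathcal{M}_m=E_0\oplus E_1\oplus\cdots\oplus E_m,$$ $$d_2(u,\mathcal{M}_m)^2=\inf_{\Phi\in\mathcal{M}_m}\|u-\Phi\|_2^2,\qquad d_{\mathcal{E}}(u,\mathcal{M}_m)^2=\inf_{\Phi\in\mathcal{M}_m}\mathcal{E}(u-\Phi).$$ *)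

(* Defs.v *)
From HB Require Import structures.
From mathcomp Require Import all_boot all_order all_algebra.
From mathcomp Require Import generic_quotient.
From mathcomp Require Import all_classical all_reals all_analysis.
From mathcomp Require Import measurable_realfun.

Set Implicit Arguments.
Unset Strict Implicit.
Unset Printing Implicit Defensive.

Import Order.TTheory GRing.Theory Num.Theory.
Import numFieldNormedType.Exports.

Local Open Scope classical_set_scope.
Local Open Scope ring_scope.
Local Open Scope quotient_scope.

(** The library's [LspaceType2 mu] is the set of a.e.-classes of square
    integrable real functions, without any structure; the first part of this
    file equips (an alias of) it with its normed space structure. *)

Definition L2 d (T : measurableType d) (R : realType)
  (mu : {measure set T -> \bar R}) : Type := LspaceType2 mu.

Section L2_structure.
Context d (T : measurableType d) (R : realType).
Variable mu : {measure set T -> \bar R}.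

Local Notation F2 := (LfunType mu (lee1n 2)).

(* the representative of a class that is chosen by the quotient *)
Definition L2_fun (u : L2 mu) : T -> R := fun x => (u : LspaceType2 mu) x.

Lemma L2_funP (u : L2 mu) : L2_fun u \in Lfun mu 2%:R%:E.
Proof.
rewrite inE; apply/andP; split; rewrite inE /=.
  exact: (@measurable_funPT _ _ _ _ (repr (LebesgueSpace.sort u))).
exact: (@Lebesgue_finite _ _ _ _ _ _ u).
Qed.

Definition L2_repr (u : L2 mu) : F2 := Lfun_Sub (lee1n 2) (L2_funP u).

Lemma ae_eq_Lnorm2 (f g : T -> R) :
  measurable_fun setT f -> measurable_fun setT g -> f = g %[ae mu] ->
  'N[mu]_(2%:R%:E)[EFin \o f]%E = 'N[mu]_(2%:R%:E)[EFin \o g]%E.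
Proof.
move=> mf mg fg; rewrite unlock /Lnorm; congr poweR.
have m2 (h : T -> R) : measurable_fun setT h ->
    measurable_fun setT (fun x => (`|(EFin \o h) x| `^ 2%:R)%E).
  move=> mh; apply: (measurableT_comp (measurable_poweR _)) => //.
  by apply: measurableT_comp => //; exact/measurable_EFinP.
apply: ae_eq_integral => //; [exact: m2|exact: m2|].
by apply: filterS fg => x /= fg /fg ->.
Qed.

Let toR (f : F2) : T -> measurableTypeR R := f.
Let toR_measurable (f : F2) : measurable_fun setT (toR f).
Proof. exact: (@measurable_funPT _ _ _ _ f). Qed.
HB.instance Definition _ (f : F2) :=
  isMeasurableFun.Build _ _ _ _ (toR f) (toR_measurable f).

Definition L2_class_mfun (f : F2) : {mfun_ mu, T >-> measurableTypeR R} :=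
  \pi_({mfun_ mu, T >-> measurableTypeR R}) (toR f).

Lemma L2_class_mfunE (f : F2) : (L2_class_mfun f : T -> R) = f %[ae mu].
Proof.
have /eqmodP/asboolP : repr (L2_class_mfun f) = toR f
  %[mod {mfun_ mu, T >-> measurableTypeR R}] by rewrite reprK.
by [].
Qed.

Lemma L2_class_subproof (f : F2) : finite_norm mu 2%:R%:E (L2_class_mfun f).
Proof.
rewrite /finite_norm (@ae_eq_Lnorm2 _ f).
- exact: Lfunction_finite.
- exact: (@measurable_funPT _ _ _ _ (repr (L2_class_mfun f))).
- exact: measurable_funPT.
- exact: L2_class_mfunE.
Qed.

Definition L2_class (f : F2) : L2 mu :=
  LebesgueSpace.Pack (LebesgueSpace.Class
    (isFinLebesgue.Build _ _ _ mu _ (lee1n 2) (L2_class_mfun f)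
      (L2_class_subproof f))).

Lemma L2_classE (f : F2) : L2_fun (L2_class f) = f %[ae mu].
Proof. exact: L2_class_mfunE. Qed.

Lemma L2_eqP (u v : L2 mu) : L2_fun u = L2_fun v %[ae mu] -> u = v.
Proof.
move: u v => [u [[fu]]] [v [[fv]]] uv.
have E : u = v by rewrite -[u]reprK -[v]reprK; exact/eqmodP/asboolP.
by subst v; rewrite (Prop_irrelevance fu fv).
Qed.

Definition L2_add (u v : L2 mu) : L2 mu := L2_class (L2_repr u + L2_repr v).
Definition L2_opp (u : L2 mu) : L2 mu := L2_class (- L2_repr u).
Definition L2_zero : L2 mu := L2_class 0.
Definition L2_scale (a : R) (u : L2 mu) : L2 mu := L2_class (a *: L2_repr u).

Let filter_app2 (P Q S : set T) :
  (\forall x \ae mu, P x -> Q x -> S x) ->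
  (\forall x \ae mu, P x) -> (\forall x \ae mu, Q x) -> \forall x \ae mu, S x.
Proof. by apply: filterS3 => x h p q; exact: h. Qed.

Let addE u v : L2_fun (L2_add u v) = L2_fun u \+ L2_fun v %[ae mu].
Proof. exact: L2_classE. Qed.

Let oppE u : L2_fun (L2_opp u) = \- L2_fun u %[ae mu].
Proof. exact: L2_classE. Qed.

Let zeroE : L2_fun L2_zero = (fun=> 0) %[ae mu].
Proof. exact: L2_classE. Qed.

Let scaleE a u : L2_fun (L2_scale a u) = (fun x => a * L2_fun u x) %[ae mu].
Proof. exact: L2_classE. Qed.

Let addA : associative L2_add.
Proof.
move=> u v w; apply: L2_eqP; move: (addE (L2_add u v) w) (addE u v).
apply: filter_app2; move: (addE u (L2_add v w)) (addE v w).
by apply: filterS2 => x /= h1 h2 h3 h4 _; rewrite h1// h2// h3// h4// addrA.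
Qed.

Let addC : commutative L2_add.
Proof.
move=> u v; apply: L2_eqP; move: (addE u v) (addE v u).
by apply: filterS2 => x /= h1 h2 _; rewrite h1// h2// addrC.
Qed.

Let add0 : left_id L2_zero L2_add.
Proof.
move=> u; apply: L2_eqP; move: (addE L2_zero u) zeroE.
by apply: filterS2 => x /= h1 h2 _; rewrite h1// h2// add0r.
Qed.

Let addN : left_inverse L2_zero L2_opp L2_add.
Proof.
move=> u; apply: L2_eqP; move: (addE (L2_opp u) u) (oppE u) zeroE.
by apply: filterS3 => x /= h1 h2 h3 _; rewrite h1// h2// h3// addNr.
Qed.

HB.instance Definition _ := gen_eqMixin (L2 mu).
HB.instance Definition _ := gen_choiceMixin (L2 mu).
HB.instance Definition _ := GRing.isZmodule.Build (L2 mu) addA addC add0 addN.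

Let scaleA a b (u : L2 mu) : L2_scale a (L2_scale b u) = L2_scale (a * b) u.
Proof.
apply: L2_eqP; move: (scaleE a (L2_scale b u)) (scaleE b u) (scaleE (a * b) u).
by apply: filterS3 => x /= h1 h2 h3 _; rewrite h1// h2// h3// mulrA.
Qed.

Let scale1 : left_id 1 L2_scale.
Proof.
move=> u; apply: L2_eqP; move: (scaleE 1 u).
by apply: filterS => x /= h1 _; rewrite h1// mul1r.
Qed.

Let scaleDr : right_distributive L2_scale +%R.
Proof.
move=> a u v; apply: L2_eqP; move: (scaleE a u) (scaleE a v).
apply: filter_app2; move: (scaleE a (u + v)) (addE u v)
  (addE (L2_scale a u) (L2_scale a v)).
apply: filterS3 => x /= h1 h2 h3 h4 h5 _.
by rewrite h1// h2// [RHS]h3// h4// h5// mulrDr.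
Qed.

Let scaleDl u : {morph L2_scale^~ u : a b / a + b}.
Proof.
move=> a b; apply: L2_eqP; move: (scaleE a u) (scaleE b u).
apply: filter_app2; move: (scaleE (a + b) u)
  (addE (L2_scale a u) (L2_scale b u)).
apply: filterS2 => x /= h1 h2 h3 h4 _.
by rewrite h1// [RHS]h2// h3// h4// mulrDl.
Qed.

HB.instance Definition _ := GRing.Zmodule_isLmodule.Build R (L2 mu)
  scaleA scale1 scaleDr scaleDl.

Definition L2_norm (u : L2 mu) : R :=
  fine ('N[mu]_(2%:R%:E)[EFin \o L2_fun u]%E).

Let L2_norm_class (f : F2) :
  L2_norm (L2_class f) = fine ('N[mu]_(2%:R%:E)[EFin \o f]%E).
Proof.
congr fine; apply: ae_eq_Lnorm2 (L2_classE f).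
  by have := L2_funP (L2_class f); rewrite inE => /andP[]; rewrite inE.
exact: measurable_funPT.
Qed.

Let L2_normD (u v : L2 mu) : L2_norm (u + v) <= L2_norm u + L2_norm v.
Proof. by rewrite L2_norm_class; exact: ler_LnormD (L2_repr u) (L2_repr v). Qed.

Let L2_normZ (a : R) (u : L2 mu) : L2_norm (a *: u) = `|a| * L2_norm u.
Proof.
rewrite L2_norm_class; apply: EFin_inj; rewrite EFinM.
rewrite -[L2_norm u]/(fine ('N[mu]_(2%:R%:E)[EFin \o L2_repr u]%E)).
by rewrite !finite_norm_fine -LnormZ.
Qed.

Let L2_norm_eq0 (u : L2 mu) : L2_norm u = 0 -> u = 0.
Proof.
move=> u0; apply: L2_eqP; move: zeroE (fine_Lnormr_eq0 (u0 : fine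
  ('N[mu]_(2%:R%:E)[EFin \o L2_repr u]%E) = 0)).
by apply: filterS2 => x /= h1 h2 _; rewrite [RHS]h1//; exact: h2.
Qed.

HB.instance Definition _ := Lmodule_isNormed.Build R (L2 mu)
  L2_normD L2_normZ L2_norm_eq0.

Lemma L2_funD (u v : L2 mu) : L2_fun (u + v) = L2_fun u \+ L2_fun v %[ae mu].
Proof. exact: addE. Qed.

Lemma L2_funN (u : L2 mu) : L2_fun (- u) = \- L2_fun u %[ae mu].
Proof. exact: oppE. Qed.

Lemma L2_fun0 : L2_fun 0 = (fun=> 0) %[ae mu].
Proof. exact: zeroE. Qed.

Lemma L2_funZ (a : R) (u : L2 mu) :
  L2_fun (a *: u) = (fun x => a * L2_fun u x) %[ae mu].
Proof. exact: scaleE. Qed.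

Lemma L2_normE (u : L2 mu) :
  `|u| = fine ('N[mu]_(2%:R%:E)[EFin \o L2_fun u]%E).
Proof. by []. Qed.

Definition L2_dot (u v : L2 mu) : R := \int[mu]_x (L2_fun u x * L2_fun v x).

Lemma L2_dotuu (u : L2 mu) : L2_dot u u = `|u| ^+ 2.
Proof.
apply: EFin_inj; rewrite -powR_mulrn ?normr_ge0// -poweR_EFin.
rewrite L2_normE (finite_norm_fine (L2_repr u)) poweR_Lnorm ?pnatr_eq0//.
rewrite /L2_dot /Rintegral fineK.
  apply: eq_integral => x _ /=.
  by rewrite powR_mulrn ?normr_ge0// real_normK ?num_real// expr2.
apply: integrable_fin_num => //.
exact: Lfun2_integrable_sqr (L2_funP u).
Qed.

End L2_structure.

Section unbounded_operators.
Context d (T : measurableType d) (R : realType).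
Variable mu : {measure set T -> \bar R}.
Local Notation H := (L2 mu).

(** A linear operator with domain [dom]; the values of [op_fun] outside of
    [dom] are irrelevant and are never used. *)
Record unbounded_operator := UnboundedOperator {
  dom : set H ;
  op_fun :> H -> H ;
  dom0 : dom 0 ;
  dom_linear : forall (a : R) u v, dom u -> dom v -> dom (a *: u + v) ;
  op_linear : forall (a : R) u v, dom u -> dom v ->
    op_fun (a *: u + v) = a *: op_fun u + op_fun v
}.

Implicit Types (A : unbounded_operator) (u v w : H).

(* the pairs (v, w) such that v is in the domain of the adjoint, with image w *)
Definition adjoint_graph A v w :=
  forall u, dom A u -> L2_dot (A u) v = L2_dot u w.

Definition self_adjoint A :=
  dense (dom A) /\ forall v w, adjoint_graph A v w <-> dom A v /\ A v = w.

Definition nonnegative A := forall u, dom A u -> 0 <= L2_dot (A u) u.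

Definition compact_operator (K : H -> H) :=
  compact (closure (K @` [set f | `|f| <= 1])).

(* K is the two-sided inverse of A - z : dom A -> L2 *)
Definition is_resolvent A (z : R) (K : H -> H) :=
  (forall f, dom A (K f) /\ A (K f) - z *: K f = f) /\
  (forall u, dom A u -> K (A u - z *: u) = u).

(* By the resolvent identity, compactness at one point of the resolvent set
   amounts to compactness at all of them. *)
Definition compact_resolvent A :=
  exists z K, is_resolvent A z K /\ compact_operator K.

Definition op_eigenspace A (l : R) : set H := [set u | dom A u /\ A u = l *: u].

Definition op_eigenvalue A (l : R) := exists2 u, op_eigenspace A l u & u != 0.

Definition constant_functions : set H :=
  [set u | exists c : R, L2_fun u = (fun=> c) %[ae mu]].

(** The quadratic form of a nonnegative self-adjoint operator is the closure of
    the form u |-> <A u, u> on [dom A]: u is in the form domain when it is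
    the L2-limit of a sequence of [dom A] which is Cauchy for the form, and
    [energy A u] is the limit of <A u_n, u_n> (which does not depend on the
    sequence, the form being closable). *)
Definition form_approx A u (u_ : nat -> H) := [/\
  forall n, dom A (u_ n),
  u_ @ \oo --> u &
  forall e : R, 0 < e -> exists N, forall i j, (N <= i)%N -> (N <= j)%N ->
    L2_dot (A (u_ i - u_ j)) (u_ i - u_ j) < e].

Definition form_domain A : set H :=
  [set u | exists u_ : nat -> H, form_approx A u u_].

Definition energy A u : R :=
  xget 0 [set e | exists2 u_ : nat -> H, form_approx A u u_ &
                    (fun n => L2_dot (A (u_ n)) (u_ n)) @ \oo --> e].

(* The orthogonal projection of u onto V. It is the element of V singled out
   here whenever that element exists, as it does for finite-dimensional V. *)
Definition orth_proj (V : set H) u : H :=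
  xget 0 [set p | V p /\ forall v, V v -> L2_dot (u - p) v = 0].

(** In what follows [m k] is the k-th eigenvalue of [A]. *)

Definition variance A (m : nat -> R) u : R :=
  `|u - orth_proj (op_eigenspace A (m 0%N)) u| ^+ 2.

Definition deficit A (m : nat -> R) u : R :=
  energy A u - m 1%N * variance A m u.

Definition eigen_sum A (m : nat -> R) (n : nat) : set H :=
  [set Phi | exists2 v : 'I_n.+1 -> H,
     forall k : 'I_n.+1, op_eigenspace A (m k) (v k) & Phi = \sum_k v k].

Definition L2_dist2 u (M : set H) : R := inf [set `|u - Phi| ^+ 2 | Phi in M].

Definition energy_dist2 A u (M : set H) : R :=
  inf [set energy A (u - Phi) | Phi in M].

(* ||u_k||^2, where u_k is the component of u in the k-th eigenspace *)
Definition component_norm2 A (m : nat -> R) (k : nat) u : R :=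
  `|orth_proj (op_eigenspace A (m k)) u| ^+ 2.

End unbounded_operators.

(* Main.v *)
Require Import Defs.
From mathcomp Require Import all_boot all_order all_algebra.
From mathcomp Require Import all_classical all_reals all_analysis.
From mathcomp Require Import measurable_realfun.
From mathcomp Require Import ring lra.

Set Implicit Arguments.
Unset Strict Implicit.
Unset Printing Implicit Defensive.

Import Order.TTheory GRing.Theory Num.Theory.
Import numFieldNormedType.Exports.

Local Open Scope classical_set_scope.
Local Open Scope ring_scope.

(** Write [a_k] for the squared norm of the component of [u] in the [k]-th
    eigenspace. Everything rests on two expansions: [|u|^2 = sum_k a_k] for all
    [u] in L2, and [energy A u = sum_k m_k a_k] for all [u] in the form domain.
    They turn the squared distances into tails of these series: the best
    approximation of [u] by the first [n] eigenspaces is the partial sum of its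
    expansion, for the norm as well as for the energy, so that [d_2^2] is
    [sum_(k >= n) a_k] and [d_E^2] is [sum_(k >= n) m_k a_k]. The two differences
    of the theorem are then linear expressions in [|u|^2], the energy and
    [a_0, ..., a_3], and by algebra ([L2_remainder], [energy_remainder]) they are
    equal to [sum_(k >= 4) (m_k - m_3) a_k] and to [m_1 / m_3] times this sum. The
    terms being nonnegative, both inequalities hold, and equality means that
    [a_k = 0] for all [k >= 4]. An eigenvector for [m_3] is a case of equality
    with nonzero distances, which makes the constants sharp.

    The first expansion is the spectral theorem for the compact symmetric
    resolvent [K], in a space with an inner product that need not be complete.
    Compactness replaces completeness three times: it gives an eigenvector of [K]
    in every closed invariant subspace that [K] does not annihilate
    ([compact_symmetric_eigenvector]), so that a vector orthogonal to all the
    eigenspaces is 0 ([eigenspaces_total]); it gives the orthogonal projections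
    onto the eigenspaces ([resolvent_orth_projection]); and it gives cluster points
    of the remainders of the expansion, which must be 0 ([expansion_cvg]).

    The second expansion ([form_sum_cvg], [form_domain_energy]) is first obtained
    on the domain of [A], where [<A u, u>] is the limit of [<A s_n, u>] along the
    partial sums [s_n]. It passes to the form domain because each truncation of the
    form is the square of a seminorm that is continuous on L2. *)

(** * Normed spaces whose norm comes from an inner product *)

Record inner_product (R : realType) (V : normedModType R) (dot : V -> V -> R) :=
  InnerProduct {
  dotC : forall u v, dot u v = dot v u ;
  dotDl : forall u v w, dot (u + v) w = dot u w + dot v w ;
  dotZl : forall a u v, dot (a *: u) v = a * dot u v ;
  dotuu : forall u, dot u u = `|u| ^+ 2
}.

Definition linear_subspace (R : realType) (V : normedModType R) (E : set V) :=
  E 0 /\ forall (a : R) u v, E u -> E v -> E (a *: u + v).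

Section inner_product_theory.
Context {R : realType} {V : normedModType R} {dot : V -> V -> R}.
Hypothesis ip : inner_product dot.
Implicit Types (u v w : V) (a : R).

Lemma dotNl u v : dot (- u) v = - dot u v.
Proof. by rewrite -scaleN1r (dotZl ip) mulN1r. Qed.

Lemma dotBl u v w : dot (u - v) w = dot u w - dot v w.
Proof. by rewrite (dotDl ip) dotNl. Qed.

Lemma dotDr u v w : dot w (u + v) = dot w u + dot w v.
Proof. by rewrite (dotC ip) (dotDl ip) !(dotC ip w). Qed.

Lemma dotZr a u v : dot u (a *: v) = a * dot u v.
Proof. by rewrite (dotC ip) (dotZl ip) (dotC ip u). Qed.

Lemma dotNr u v : dot u (- v) = - dot u v.
Proof. by rewrite (dotC ip) dotNl (dotC ip u). Qed.

Lemma dotBr u v w : dot w (u - v) = dot w u - dot w v.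
Proof. by rewrite dotDr dotNr. Qed.

Lemma dot0l u : dot 0 u = 0.
Proof. by rewrite -(subrr u) dotBl subrr. Qed.

Lemma dot0r u : dot u 0 = 0.
Proof. by rewrite (dotC ip) dot0l. Qed.

Lemma dot_suml (I : Type) (r : seq I) (P : pred I) (F : I -> V) u :
  dot (\sum_(i <- r | P i) F i) u = \sum_(i <- r | P i) dot (F i) u.
Proof.
by apply: (big_morph (dot^~ u)); [move=> v w; exact: (dotDl ip)|exact: dot0l].
Qed.

Lemma dot_sumr (I : Type) (r : seq I) (P : pred I) (F : I -> V) u :
  dot u (\sum_(i <- r | P i) F i) = \sum_(i <- r | P i) dot u (F i).
Proof.
by rewrite (dotC ip) dot_suml; apply: eq_bigr => i _; exact: (dotC ip).
Qed.

Lemma normD_sqr u v : `|u + v| ^+ 2 = `|u| ^+ 2 + 2 * dot u v + `|v| ^+ 2.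
Proof. by rewrite -!(dotuu ip) !((dotDl ip), dotDr) (dotC ip v u); ring. Qed.

Lemma normB_sqr u v : `|u - v| ^+ 2 = `|u| ^+ 2 - 2 * dot u v + `|v| ^+ 2.
Proof. by rewrite normD_sqr dotNr normrN; ring. Qed.

Lemma normD_sqr_orth u v :
  dot u v = 0 -> `|u + v| ^+ 2 = `|u| ^+ 2 + `|v| ^+ 2.
Proof. by move=> uv; rewrite normD_sqr uv mulr0 addr0. Qed.

Lemma dot_orth_refl u : dot u u = 0 -> u = 0.
Proof. by move/eqP; rewrite (dotuu ip) sqrf_eq0 normr_eq0 => /eqP. Qed.

(** Both sides times [|v|^2] differ by the square of the norm of
    [|v|^2 u - <u, v> v]. *)
Lemma norm_dot_le u v : `|dot u v| <= `|u| * `|v|.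
Proof.
have [->|v0] := eqVneq v 0; first by rewrite dot0r !normr0 mulr0.
have v2 : 0 < `|v| ^+ 2 by rewrite exprn_gt0// normr_gt0.
rewrite -ler_sqr ?nnegrE ?mulr_ge0// exprMn real_normK ?num_real//.
rewrite -subr_ge0 -(pmulr_rge0 _ v2).
have -> : `|v| ^+ 2 * (`|u| ^+ 2 * `|v| ^+ 2 - dot u v ^+ 2) =
    `|(`|v| ^+ 2) *: u - dot u v *: v| ^+ 2.
  rewrite normB_sqr (dotZl ip) dotZr !normrZ !exprMn.
  by rewrite !real_normK ?num_real//; ring.
exact: sqr_ge0.
Qed.

Lemma lipschitz_continuous (W : normedModType R) (f : V -> W) (C : R) :
  (forall u w, `|f u - f w| <= C * `|u - w|) -> continuous f.
Proof.
move=> fC u; apply/cvgrPdist_le => e e0.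
have p0 : 0 < `|C| + 1 by rewrite ltr_wpDl.
near=> w; apply: le_trans (fC _ _) _.
apply: (@le_trans _ _ ((`|C| + 1) * `|u - w|)).
  by rewrite ler_wpM2r// (le_trans (ler_norm C))// lerDl.
rewrite mulrC -ler_pdivlMr//.
by near: w; apply: cvgr_dist_le; [exact: cvg_id|rewrite divr_gt0].
Unshelve. all: by end_near. Qed.

Lemma dot_continuous v : continuous (dot v).
Proof.
apply: (lipschitz_continuous (C := `|v|)) => u w.
by rewrite -dotBr norm_dot_le.
Qed.

Lemma closed_orthogonal v : closed [set u | dot v u = 0].
Proof.
have -> : [set u | dot v u = 0] = dot v @^-1` [set 0] by [].
by apply: closed_comp => [u _|]; [exact: dot_continuous|exact: closed_eq].
Qed.

(** If [p] minimizes the distance from [u] to [E], then moving [p] along [v]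
    does not decrease the distance; the derivative of
    [t |-> |u - p - t v|^2] at 0 therefore vanishes. *)
Lemma orth_of_min_dist (E : set V) u p : linear_subspace E -> E p ->
  (forall v, E v -> `|u - p| <= `|u - v|) -> forall v, E v -> dot (u - p) v = 0.
Proof.
move=> [E0 El] Ep pmin v Ev.
have [->|v0] := eqVneq v 0; first by rewrite dot0r.
have v2 : 0 < `|v| ^+ 2 by rewrite exprn_gt0// normr_gt0.
set a := dot (u - p) v; pose t := a / `|v| ^+ 2.
have /pmin : E (t *: v + p) by exact: El.
rewrite -ler_sqr ?nnegrE// (addrC _ p) opprD addrA (normB_sqr (u - p)).
rewrite dotZr -/a normrZ exprMn real_normK ?num_real//.
rewrite -addrA lerDl => h.
suff : a ^+ 2 <= 0 by rewrite le_eqVlt ltNge sqr_ge0 orbF sqrf_eq0 => /eqP.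
have -> : a ^+ 2 = (2 * (t * a) - t ^+ 2 * `|v| ^+ 2) * `|v| ^+ 2.
  by rewrite /t; field; rewrite -normr_gt0 ?normr_id normr_gt0.
rewrite -oppr_ge0 -mulNr mulr_ge0 ?(ltW v2)//.
by move: h; lra.
Qed.

(** The distance to [u] attains its minimum on the part of [E] in the ball of
    radius [2 |u|]; the points of [E] outside of it are farther from [u] than
    [0] is. *)
Lemma projection_exists (E : set V) u : linear_subspace E ->
  (forall r, compact (E `&` [set e | `|e| <= r])) ->
  exists p, E p /\ forall v, E v -> dot (u - p) v = 0.
Proof.
move=> lE cE; have [E0 _] := lE.
have B0 : (E `&` [set e | `|e| <= 2 * `|u|]) 0.
  by split => //=; rewrite normr0 mulr_ge0.
have fcont : continuous (fun e => `|u - e|).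
  apply: (lipschitz_continuous (C := 1)) => e e'; rewrite mul1r.
  apply: le_trans (ler_dist_dist _ _) _.
  by rewrite opprB addrC addrA addrNK distrC.
have [p] := compact_EVT_min (ex_intro _ _ B0) (cE _) (continuous_subspaceT fcont).
rewrite inE => -[Ep _] pmin; exists p; split=> //.
apply: orth_of_min_dist => // v Ev.
have [vu|vu] := leP `|v| (2 * `|u|).
  by apply: pmin; rewrite inE.
apply: (@le_trans _ _ `|u - 0|); first by apply: pmin; rewrite inE.
rewrite subr0 distrC; apply: le_trans (lerB_dist _ _).
by rewrite lerBrDr; lra.
Qed.

End inner_product_theory.

Section linear_maps.
Context {R : realType} {V : normedModType R} {K : V -> V}.
Hypothesis K_linear : forall (a : R) u v, K (a *: u + v) = a *: K u + K v.

Lemma linear_map0 : K 0 = 0.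
Proof.
by have := K_linear (-1) 0 0; rewrite scaler0 addr0 scaleN1r addNr.
Qed.

Lemma linear_mapZ a u : K (a *: u) = a *: K u.
Proof. by rewrite -[a *: u]addr0 K_linear linear_map0 addr0. Qed.

Lemma linear_mapB u v : K (u - v) = K u - K v.
Proof. by rewrite addrC -scaleN1r K_linear scaleN1r addrC. Qed.

End linear_maps.

(** * Compact symmetric operators *)

Section compact_symmetric_operators.
Context {R : realType} {V : normedModType R} {dot : V -> V -> R}.
Hypothesis ip : inner_product dot.
Implicit Types (u v w : V) (a : R).
Context {K : V -> V}.
Hypothesis K_linear : forall a u v, K (a *: u + v) = a *: K u + K v.
Hypothesis K_compact : compact (closure (K @` [set f | `|f| <= 1])).

Let K0 := linear_map0 K_linear.
Let KZ := linear_mapZ K_linear.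
Let KB := linear_mapB K_linear.

Lemma compact_bounded_op : exists2 C : R, 0 < C & forall f, `|K f| <= C * `|f|.
Proof.
have /ex_strict_bound_gt0[C C0 hC] := compact_bounded K_compact.
exists C => // f.
have [->|f0] := eqVneq f 0; first by rewrite K0 !normr0 mulr0.
have nf : 0 < `|f| by rewrite normr_gt0.
have : `|K (`|f|^-1 *: f)| < C.
  apply: hC; apply: subset_closure; exists (`|f|^-1 *: f) => //=.
  by rewrite normrZ normfV normr_id mulVf// gt_eqF.
by rewrite KZ normrZ normfV normr_id mulrC ltr_pdivrMr// => /ltW.
Qed.

Lemma compact_op_continuous : continuous K.
Proof.
have [C _ hC] := compact_bounded_op.
by apply: (lipschitz_continuous (C := C)) => u w; rewrite -KB.
Qed.

(** On the eigenspace of a nonzero eigenvalue [k], the ball of radius [r] is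
    contained in the image under [K] of the ball of radius [r / k]. *)
Lemma compact_eigenspace_ball (k r : R) : k != 0 ->
  compact ([set e | K e = k *: e] `&` [set e | `|e| <= r]).
Proof.
move=> k0; have [r0|r0] := ltP r 0.
  rewrite (_ : _ `&` _ = set0); first exact: compact0.
  apply/seteqP; split=> // e [_ /= /le_lt_trans/(_ r0)].
  by rewrite ltNge normr_ge0.
pose s := (`|r| + 1) / k.
have r1 : 0 < `|r| + 1 by rewrite ltr_wpDl.
have s0 : s != 0 by rewrite mulf_neq0 ?invr_neq0// gt_eqF.
have scont : continuous (fun x : V => s *: x) by exact: scaler_continuous.
apply: (@subclosed_compact _ _
  ((fun x => s *: x) @` closure (K @` [set f | `|f| <= 1]))).
- apply: closedI.
    have -> : [set e | K e = k *: e] =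
        (fun e => `|K e - k *: e|) @^-1` [set 0 : R].
      apply/seteqP; split => e /=; first by move=> ->; rewrite subrr normr0.
      by move/normr0_eq0/eqP; rewrite subr_eq0 => /eqP.
    apply: closed_comp => [e _|]; last exact: closed_eq.
    apply: cvg_norm; apply: cvgB; first exact: compact_op_continuous.
    exact: scaler_continuous.
  have -> : [set e : V | `|e| <= r] = (fun e => `|e|) @^-1` [set x | x <= r] by [].
  by apply: closed_comp => [e _|]; [exact: norm_continuous|exact: closed_le].
- by apply: continuous_compact => //; exact: continuous_subspaceT.
- move=> e [/= Ke er]; exists (s^-1 *: e); last first.
    by rewrite scalerA divff// scale1r.
  apply: subset_closure; exists ((`|r| + 1)^-1 *: e) => /=.
    rewrite normrZ normfV (gtr0_norm r1) mulrC ler_pdivrMr// mul1r.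
    by rewrite (le_trans er)// (le_trans (ler_norm r))// lerDl.
  by rewrite KZ Ke scalerA /s invf_div mulrC.
Qed.

Hypothesis K_sym : forall u v, dot (K u) v = dot u (K v).

(** Let [N] be the norm of [K] on [W]. Compactness provides a limit [g] of
    images [K f] of unit vectors with [|g| = N]. For such [h = K f],
    [|K^2 h - N^2 h|^2 <= N^4 (N^2 - |h|^2)], and this closed condition passes to
    [g], so that [K^2 g = N^2 g]; as [K^2 - N^2 = (K - N) (K + N)], one of [g]
    and [K g + N g] is an eigenvector. *)
Lemma compact_symmetric_eigenvector (W : set V) :
  linear_subspace W -> closed W -> (forall u, W u -> W (K u)) ->
  (exists2 w, W w & K w != 0) ->
  exists k e, [/\ k != 0, W e, e != 0 & K e = k *: e].
Proof.
move=> [W0 Wl] cW KW [w Ww Kw0].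
have WZ a u : W u -> W (a *: u) by move=> Wu; rewrite -[_ *: _]addr0; exact: Wl.
pose B := W `&` [set f | `|f| <= 1].
have cC : compact (closure (K @` B)).
  apply: subclosed_compact K_compact _; first exact: closed_closure.
  by apply: closureS; apply: image_subset => f [].
have B0 : closure (K @` B) 0.
  by apply: subset_closure; exists 0 => //; split=> //=; rewrite normr0.
have ncont : continuous (fun e : V => `|e|) by exact: norm_continuous.
have [g] := compact_EVT_max (ex_intro _ _ B0) cC (continuous_subspaceT ncont).
rewrite inE => gC gmax.
set N : R := `|g|.
have KN f : W f -> `|K f| <= N * `|f|.
  move=> Wf; have [->|f0] := eqVneq f 0; first by rewrite K0 !normr0 mulr0.
  have nf : 0 < `|f| by rewrite normr_gt0.
  have : `|K (`|f|^-1 *: f)| <= N.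
    apply: gmax; rewrite inE; apply: subset_closure.
    exists (`|f|^-1 *: f) => //; split; first exact: WZ.
    by rewrite /= normrZ normfV normr_id mulVf// gt_eqF.
  by rewrite KZ normrZ normfV normr_id mulrC ler_pdivrMr.
have N0 : 0 < N.
  rewrite lt_neqAle normr_ge0 andbT; apply/eqP => N0.
  by have := KN _ Ww; rewrite -N0 mul0r normr_le0 (negbTE Kw0).
have Wg : W g.
  rewrite closure_id in cW; rewrite cW.
  apply: closureS gC => _ [f [Wf _] <-].
  exact: KW.
pose D h := K (K h) - N ^+ 2 *: h.
have Dcont : continuous (fun h => `|D h| ^+ 2 + N ^+ 4 * `|h| ^+ 2).
  have sq (f : V -> R) x : f @ x --> f x -> (fun y => f y ^+ 2) @ x --> f x ^+ 2.
    by move=> fx; exact: (cvgM fx fx).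
  move=> h; apply: cvgD.
    apply: sq; apply: cvg_norm; apply: cvgB; last exact: scaler_continuous.
    by apply: continuous_comp; exact: compact_op_continuous.
  by apply: cvgM; [exact: cvg_cst|apply: sq; exact: norm_continuous].
have Dbound h : closure (K @` B) h ->
    `|D h| ^+ 2 + N ^+ 4 * `|h| ^+ 2 <= N ^+ 6.
  pose S := (fun h => `|D h| ^+ 2 + N ^+ 4 * `|h| ^+ 2) @^-1`
    [set x | x <= N ^+ 6].
  have cS : closed S.
    by apply: closed_comp => [x _|]; [exact: Dcont|exact: closed_le].
  suff : closure (K @` B) `<=` S by exact.
  rewrite (closure_id S).1//; apply: closureS => _ [f [Wf /= f1] <-].
  rewrite /S /=.
  have -> : D (K f) = K (D f) by rewrite /D KB KZ.
  have WD : W (D f).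
    by rewrite /D addrC -scaleNr; apply: Wl => //; exact: KW _ (KW _ Wf).
  have h1 : `|K (D f)| ^+ 2 <= N ^+ 2 * `|D f| ^+ 2.
    by rewrite -exprMn ler_sqr ?nnegrE ?mulr_ge0 ?(ltW N0)// KN.
  have h2 : `|K (K f)| ^+ 2 <= N ^+ 2 * `|K f| ^+ 2.
    by rewrite -exprMn ler_sqr ?nnegrE ?mulr_ge0 ?(ltW N0)// KN//; exact: KW.
  have h3 : `|f| ^+ 2 <= 1 by rewrite expr_le1.
  (* symmetry of [K] turns the cross term [<K (K f), f>] into [|K f|^2] *)
  have h4 : `|D f| ^+ 2 <= N ^+ 4 - N ^+ 2 * `|K f| ^+ 2.
    rewrite /D (normB_sqr ip) (dotZr ip) K_sym (dotuu ip) normrZ exprMn.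
    rewrite (ger0_norm (sqr_ge0 _)) -exprM.
    have : N ^+ 4 * `|f| ^+ 2 <= N ^+ 4 * 1.
      by rewrite ler_wpM2l// exprn_ge0// ltW.
    rewrite mulr1; lra.
  have h5 : N ^+ 2 * `|D f| ^+ 2 <= N ^+ 2 * (N ^+ 4 - N ^+ 2 * `|K f| ^+ 2).
    by rewrite ler_wpM2l// sqr_ge0.
  rewrite -lerBrDr (le_trans h1)// (le_trans h5)// le_eqVlt; apply/orP; left.
  by apply/eqP; ring.
have KKg : K (K g) = N ^+ 2 *: g.
  have := Dbound _ gC; rewrite -/N -exprD gerDr => Dg0.
  have /eqP : `|D g| ^+ 2 == 0 by rewrite eq_le Dg0 sqr_ge0.
  by move/eqP; rewrite sqrf_eq0 normr_eq0 subr_eq0 => /eqP.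
have g0 : g != 0 by rewrite -normr_gt0.
have [e0|e0] := eqVneq (K g + N *: g) 0.
  exists (- N), g; split=> //; first by rewrite oppr_eq0 gt_eqF.
  by apply/eqP; rewrite scaleNr -addr_eq0 e0.
exists N, (K g + N *: g); split=> //; first by rewrite gt_eqF.
  by rewrite addrC; apply: Wl => //; exact: KW.
by rewrite addrC K_linear KKg scalerDr scalerA expr2 addrC.
Qed.

End compact_symmetric_operators.

(** * Eigenspaces of an operator with compact resolvent *)

(** An unbounded operator: the values of [A] outside of [D] are arbitrary. *)
Record symmetric_operator (R : realType) (V : normedModType R)
  (dot : V -> V -> R) (D : set V) (A : V -> V) := SymmetricOperator {
  sop_dom : linear_subspace D ;
  sop_linear : forall (a : R) u v, D u -> D v ->
    A (a *: u + v) = a *: A u + A v ;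
  sop_sym : forall u v, D u -> D v -> dot (A u) v = dot u (A v)
}.

Definition eigen_subspace (R : realType) (V : normedModType R) (D : set V)
  (A : V -> V) (l : R) : set V := [set u | D u /\ A u = l *: u].

Definition has_eigenvalue (R : realType) (V : normedModType R) (D : set V)
  (A : V -> V) (l : R) := exists2 u, eigen_subspace D A l u & u != 0.

Definition orth_projection (R : realType) (V : normedModType R)
    (dot : V -> V -> R) (E : set V) (P : V -> V) :=
  forall u, E (P u) /\ forall v, E v -> dot (u - P u) v = 0.

Section symmetric_operators.
Context {R : realType} {V : normedModType R} {dot : V -> V -> R}.
Hypothesis ip : inner_product dot.
Context {D : set V} {A : V -> V}.
Hypothesis sA : symmetric_operator dot D A.
Implicit Types u v w f g : V.

Lemma op_fun0 : A 0 = 0.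
Proof.
have [D0 _] := sop_dom sA; have := sop_linear sA (-1) D0 D0.
by rewrite scaler0 addr0 scaleN1r addNr.
Qed.

Lemma domZ (a : R) u : D u -> D (a *: u).
Proof.
by have [D0 Dl] := sop_dom sA; move=> Du; rewrite -[_ *: _]addr0; exact: Dl.
Qed.

Lemma op_funZ (a : R) u : D u -> A (a *: u) = a *: A u.
Proof.
have [D0 _] := sop_dom sA.
by move=> Du; rewrite -[a *: u]addr0 (sop_linear sA)// op_fun0 addr0.
Qed.

Lemma domB u v : D u -> D v -> D (u - v).
Proof.
by move=> Du Dv; rewrite addrC -scaleN1r; exact: (sop_dom sA).2.
Qed.

Lemma eigenspace_subspace l : linear_subspace (eigen_subspace D A l).
Proof.
have [D0 Dl] := sop_dom sA.
split=> [|a u v [Du Au] [Dv Av]]; first by split; rewrite ?op_fun0 ?scaler0.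
split; first exact: Dl.
by rewrite (sop_linear sA)// Au Av scalerDr !scalerA mulrC.
Qed.

Lemma eigenspace_orth l l' u v :
  l != l' -> eigen_subspace D A l u -> eigen_subspace D A l' v -> dot u v = 0.
Proof.
move=> ll' [Du Au] [Dv Av]; have := sop_sym sA Du Dv.
rewrite Au Av (dotZl ip) (dotZr ip) => /eqP.
by rewrite -subr_eq0 -mulrBl mulf_eq0 subr_eq0 (negbTE ll') => /eqP.
Qed.

Context {z : R} {K : V -> V}.
Hypothesis KA : (forall f, D (K f) /\ A (K f) - z *: K f = f) /\
  (forall u, D u -> K (A u - z *: u) = u).

Lemma resolvent_linear (a : R) f g : K (a *: f + g) = a *: K f + K g.
Proof.
have [KA1 KA2] := KA; have [[Df Af] [Dg Ag]] := (KA1 f, KA1 g).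
have /KA2 <- : D (a *: K f + K g) by exact: (sop_dom sA).2.
congr K; rewrite (sop_linear sA)// -{1}Af -{1}Ag !scalerDr opprD addrACA.
by rewrite scalerN !scalerA (mulrC a).
Qed.

Lemma resolvent_sym f g : dot (K f) g = dot f (K g).
Proof.
have [[Df Af] [Dg Ag]] := (KA.1 f, KA.1 g).
rewrite -{1}Ag -{2}Af (dotBr ip) (dotBl ip) (sop_sym sA)//.
by rewrite (dotZl ip) (dotZr ip).
Qed.

Lemma resolvent_inj f : K f = 0 -> f = 0.
Proof. by move=> Kf; have [_ <-] := KA.1 f; rewrite Kf op_fun0 scaler0 subrr. Qed.

(** An eigenvector for [z] would be in the kernel of [A - z], which has the left
    inverse [K]. *)
Lemma eigenvalue_neq_resolvent l : has_eigenvalue D A l -> l != z.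
Proof.
move=> [u [Du Au] u0]; apply: contra_neq u0 => lz.
have := KA.2 u Du; rewrite Au lz subrr => <-.
exact: linear_map0 resolvent_linear.
Qed.

(** This replaces the unbounded operator by a continuous one: eigenspaces are
    closed, with compact balls. *)
Lemma resolvent_eigenspace l : l != z ->
  eigen_subspace D A l = [set e | K e = (l - z)^-1 *: e].
Proof.
rewrite -subr_eq0 => lz; apply/seteqP; split=> e /=.
  move=> [De Ae]; have [K1 K2] := KA.
  have := K2 e De; rewrite Ae -scalerBl (linear_mapZ resolvent_linear) => {2}<-.
  by rewrite scalerA mulVf// scale1r.
move=> Ke; have [DKe AKe] := KA.1 e.
have eE : e = (l - z) *: K e by rewrite Ke scalerA divff// scale1r.
have De : D e by rewrite eE; exact: domZ.
split=> //; move: AKe; rewrite Ke op_funZ// scalerA => h.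
have {h} : (l - z) *: ((l - z)^-1 *: A e - (z * (l - z)^-1) *: e) = (l - z) *: e.
  by rewrite h.
rewrite scalerBr !scalerA divff// scale1r mulrCA divff// mulr1 => /eqP.
by rewrite subr_eq -scalerDl subrK => /eqP.
Qed.

Hypothesis K_compact : compact (closure (K @` [set f | `|f| <= 1])).

(** The eigenspaces of [A] are eigenspaces of the compact operator [K] for nonzero
    eigenvalues, in which nearest points exist. *)
Lemma resolvent_orth_projection l : has_eigenvalue D A l ->
  exists P, orth_projection dot (eigen_subspace D A l) P.
Proof.
move=> /eigenvalue_neq_resolvent lz.
suff /choice[P hP] : forall u, exists p, eigen_subspace D A l p /\
    forall v, eigen_subspace D A l v -> dot (u - p) v = 0 by exists P.
move=> u; apply: projection_exists => //; first exact: eigenspace_subspace.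
move=> r; rewrite resolvent_eigenspace//.
apply: compact_eigenspace_ball => //; first exact: resolvent_linear.
by rewrite invr_eq0 subr_eq0.
Qed.

(** Otherwise [K] would have an eigenvector in the orthogonal complement of all
    the eigenspaces of [A]; but eigenvectors of [K] are eigenvectors of [A]. *)
Lemma eigenspaces_total u :
  (forall l v, eigen_subspace D A l v -> dot v u = 0) -> u = 0.
Proof.
move=> hu; pose W := [set w | forall l v, eigen_subspace D A l v -> dot v w = 0].
apply/eqP; apply: contraT => u0.
have WK w : W w -> W (K w).
  move=> Ww l v Ev; have [->|v0] := eqVneq v 0; first by rewrite (dot0l ip).
  have lz : l != z by apply: eigenvalue_neq_resolvent; exists v.
  have := Ev; rewrite resolvent_eigenspace//= => Kv.
  by rewrite -resolvent_sym Kv (dotZl ip) (Ww l)// mulr0.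
have lW : linear_subspace W.
  split=> [l v _|a w w' Ww Ww' l v Ev]; first by rewrite (dot0r ip).
  by rewrite (dotDr ip) (dotZr ip) (Ww l)// (Ww' l)// mulr0 addr0.
have cW : closed W.
  rewrite (_ : W = \bigcap_(v in [set v | exists l, eigen_subspace D A l v])
      [set w | dot v w = 0]); last first.
    apply/seteqP; split=> [w Ww v [l]|w Ww l v Ev]; first exact: Ww.
    by apply: Ww; exists l.
  by apply: closed_bigI => v _; exact: closed_orthogonal ip _.
have [|k [e [k0 We e0 Ke]]] := compact_symmetric_eigenvector ip resolvent_linear
  K_compact resolvent_sym lW cW WK.
  by exists u => //; apply: contra_neq u0; exact: resolvent_inj.
have Ee : eigen_subspace D A (z + k^-1) e.
  rewrite resolvent_eigenspace/=; first by rewrite addrC addKr invrK.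
  by rewrite -subr_eq0 addrC addKr invr_eq0.
by have /(dot_orth_refl ip)/eqP := We _ _ Ee; rewrite (negbTE e0).
Qed.

Lemma orth_projection_unique (E : set V) u p q : linear_subspace E ->
  E p -> (forall v, E v -> dot (u - p) v = 0) ->
  E q -> (forall v, E v -> dot (u - q) v = 0) -> p = q.
Proof.
move=> [_ El] Ep pP Eq qP; apply/eqP; rewrite -subr_eq0; apply/eqP.
have Epq : E (p - q) by rewrite addrC -scaleN1r; exact: El.
apply: (dot_orth_refl ip).
have {1}-> : p - q = (u - q) - (u - p) by rewrite opprB [RHS]addrC subrKA.
by rewrite (dotBl ip) qP// pP// subrr.
Qed.

End symmetric_operators.

(** * Expansion in eigenvectors *)

Section expansion.
Context {R : realType} {V : normedModType R} {dot : V -> V -> R}.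
Hypothesis ip : inner_product dot.
Context {D : set V} {A : V -> V}.
Hypothesis sA : symmetric_operator dot D A.
Context {m : nat -> R} {P : nat -> V -> V}.
Hypothesis m_lt : forall i j : nat, (i < j)%N -> m i < m j.
Local Notation E k := (eigen_subspace D A (m k)).
Hypothesis PE : forall k, orth_projection dot (E k) (P k).
Implicit Types u v w f g : V.

Definition partial_sum (Q : nat -> V -> V) n u : V := \sum_(0 <= k < n) Q k u.

Let m_inj j k : j != k -> m j != m k.
Proof. by rewrite neq_ltn => /orP[] /m_lt; [move/lt_eqF ->|move/gt_eqF ->]. Qed.

Lemma component_in k u : E k (P k u).
Proof. by have [] := PE k u. Qed.

Lemma component_orth k u v : E k v -> dot (u - P k u) v = 0.
Proof. by have [_] := PE k u; exact. Qed.

Lemma component_unique k u p :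
  E k p -> (forall v, E k v -> dot (u - p) v = 0) -> P k u = p.
Proof.
have [EP PP] := PE k u.
by apply: (orth_projection_unique ip (eigenspace_subspace sA (m k)) EP PP).
Qed.

Lemma component_linear k (a : R) u v :
  P k (a *: u + v) = a *: P k u + P k v.
Proof.
apply: component_unique => [|w Ew].
  by apply: (eigenspace_subspace sA _).2; exact: component_in.
rewrite opprD addrACA -scalerBr (dotDl ip) (dotZl ip).
by rewrite !component_orth// mulr0 addr0.
Qed.

Lemma component_id k u : E k u -> P k u = u.
Proof.
by move=> Eu; apply: component_unique => // v _; rewrite subrr (dot0l ip).
Qed.

Lemma component_other j k u : j != k -> E j u -> P k u = 0.
Proof.
move=> jk Eu; apply: component_unique => [|v Ev].
  by have [] := eigenspace_subspace sA (m k).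
by rewrite subr0; exact: (eigenspace_orth ip sA (m_inj jk) Eu Ev).
Qed.

Lemma component0 k : P k 0 = 0.
Proof. exact: linear_map0 (component_linear k). Qed.

Lemma componentB k u v : P k (u - v) = P k u - P k v.
Proof. exact: linear_mapB (component_linear k) u v. Qed.

Lemma component_sum k (I : Type) (r : seq I) (F : I -> V) :
  P k (\sum_(i <- r) F i) = \sum_(i <- r) P k (F i).
Proof.
apply: (big_morph (P k)) => [u v|]; last exact: component0.
by rewrite -[u]scale1r component_linear !scale1r.
Qed.

Lemma dot_component k u v : dot (P k u) v = dot (P k u) (P k v).
Proof.
apply/eqP; rewrite -subr_eq0 -(dotBr ip) (dotC ip) component_orth//.
exact: component_in.
Qed.

Lemma component_eigen_sum j n (v : nat -> V) : (forall k, E k (v k)) ->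
  P j (\sum_(0 <= k < n) v k) = if (j < n)%N then v j else 0.
Proof.
move=> Ev; rewrite component_sum; case: ifPn => [jn|].
  rewrite (big_rem j) ?mem_index_iota//= component_id// big1_seq ?addr0// => k /=.
  rewrite mem_rem_uniq ?iota_uniq// inE => /andP[kj _].
  exact: component_other (Ev k).
rewrite -leqNgt => nj; rewrite big1_seq// => k /=; rewrite mem_index_iota => kn.
by apply: component_other (Ev k); rewrite ltn_eqF// (leq_trans _ nj).
Qed.

Lemma norm_eigen_sum n (v : nat -> V) : (forall k, E k (v k)) ->
  `|\sum_(0 <= k < n) v k| ^+ 2 = \sum_(0 <= k < n) `|v k| ^+ 2.
Proof.
move=> Ev; rewrite -(dotuu ip) {1}(dot_suml ip) big_nat [RHS]big_nat.
apply: eq_bigr => k /= kn; rewrite -{1}(component_id (Ev k)) dot_component.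
by rewrite component_eigen_sum// kn component_id// (dotuu ip).
Qed.

Lemma component_partial_sum k n u :
  P k (partial_sum P n u) = if (k < n)%N then P k u else 0.
Proof. by apply: component_eigen_sum => j; exact: component_in. Qed.

Lemma partial_sum_linear n (a : R) u v :
  partial_sum P n (a *: u + v) = a *: partial_sum P n u + partial_sum P n v.
Proof.
rewrite /partial_sum scaler_sumr -big_split/=.
by apply: eq_bigr => k _; exact: component_linear.
Qed.

Lemma partial_sumB n u v :
  partial_sum P n (u - v) = partial_sum P n u - partial_sum P n v.
Proof. exact: linear_mapB (partial_sum_linear n) u v. Qed.

Lemma partial_sumZ n (a : R) u :
  partial_sum P n (a *: u) = a *: partial_sum P n u.
Proof. exact: linear_mapZ (partial_sum_linear n) a u. Qed.

Lemma partial_sum_orth n k u v : (k < n)%N -> E k v ->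
  dot (u - partial_sum P n u) v = 0.
Proof.
move=> kn Ev; rewrite (dotC ip) -(component_id Ev) dot_component componentB.
by rewrite component_partial_sum kn subrr (dot0r ip).
Qed.

Lemma norm_partial_sum n u :
  `|partial_sum P n u| ^+ 2 = \sum_(0 <= k < n) `|P k u| ^+ 2.
Proof. by apply: norm_eigen_sum => k; exact: component_in. Qed.

Lemma norm_sub_partial_sum n u :
  `|u - partial_sum P n u| ^+ 2 = `|u| ^+ 2 - \sum_(0 <= k < n) `|P k u| ^+ 2.
Proof.
rewrite (normB_sqr ip) norm_partial_sum.
suff -> : dot u (partial_sum P n u) = \sum_(0 <= k < n) `|P k u| ^+ 2 by ring.
rewrite (dotC ip) (dot_suml ip); apply: eq_bigr => k _.
by rewrite dot_component (dotuu ip).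
Qed.

Lemma partial_sum_gap_decr n n' u : (n <= n')%N ->
  `|u - partial_sum P n' u| <= `|u - partial_sum P n u|.
Proof.
move=> nn'; rewrite -ler_sqr ?nnegrE// !norm_sub_partial_sum lerD2l lerN2.
rewrite (big_cat_nat (leq0n n) nn')/= lerDl.
by apply: sumr_ge0 => k _; exact: sqr_ge0.
Qed.

Lemma partial_sum_gap_le n u : `|u - partial_sum P n u| <= `|u|.
Proof.
have := partial_sum_gap_decr u (leq0n n).
by rewrite [partial_sum P 0 u]big_geq// subr0.
Qed.

Context {z : R} {K : V -> V}.
Hypothesis KA : (forall f, D (K f) /\ A (K f) - z *: K f = f) /\
  (forall u, D u -> K (A u - z *: u) = u).
Hypothesis K_compact : compact (closure (K @` [set f | `|f| <= 1])).
Hypothesis m_eigenvalue : forall l, has_eigenvalue D A l <-> exists k, l = m k.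

Let Ek k : has_eigenvalue D A (m k).
Proof. by apply/m_eigenvalue; exists k. Qed.

Let K_linear := resolvent_linear sA KA.

(** [K] maps [E k] to itself and, being symmetric, also its orthogonal
    complement. *)
Lemma component_resolvent k f : P k (K f) = K (P k f).
Proof.
have mz := eigenvalue_neq_resolvent sA KA (Ek k).
have Kcomp u : E k u -> K u = (m k - z)^-1 *: u.
  by move=> Eu; have := Eu; rewrite (resolvent_eigenspace sA KA mz).
have Ec := component_in k f.
apply: component_unique => [|v Ev].
  have [E0 El] := eigenspace_subspace sA (m k).
  by rewrite (Kcomp _ Ec) -[_ *: _]addr0; exact: El.
rewrite (dotBl ip) !(resolvent_sym ip sA KA) -(dotBl ip) (Kcomp _ Ev) (dotZr ip).
by rewrite component_orth// mulr0.
Qed.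

Lemma partial_sum_resolvent n f : partial_sum P n (K f) = K (partial_sum P n f).
Proof.
rewrite /partial_sum (big_morph K (id1 := 0) (op1 := +%R)).
- by apply: eq_bigr => k _; exact: component_resolvent.
- by move=> u v; rewrite -[u]scale1r K_linear !scale1r.
- exact: linear_map0 K_linear.
Qed.

(** The remainders [K f - partial_sum P n (K f)] are the images under [K] of
    [f - partial_sum P n f], of norm at most 1, so that they have a cluster point.
    It is orthogonal to all the eigenspaces, hence 0. *)
Lemma expansion_resolvent_ball f (e : R) : `|f| <= 1 -> 0 < e ->
  exists n, `|K f - partial_sum P n (K f)| < e.
Proof.
move=> f1 e0; pose x n := K f - partial_sum P n (K f).
pose C := closure (K @` [set f | `|f| <= 1]).
have xC n : C (x n).
  apply: subset_closure; exists (f - partial_sum P n f).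
    by rewrite /= (le_trans (partial_sum_gap_le _ _)).
  by rewrite (linear_mapB K_linear) -partial_sum_resolvent.
have [h [_ hclus]] :=
  K_compact _ (filterS (fun n _ => xC n) filterT : (x @ \oo) C).
have h0 : h = 0.
  apply: (eigenspaces_total ip sA KA K_compact) => l v Ev.
  have [->|v0] := eqVneq v 0; first by rewrite (dot0l ip).
  have [k lk] : exists k, l = m k by apply/m_eigenvalue; exists v.
  rewrite {}lk in Ev.
  have cS : closed [set u | dot v u = 0] by exact: closed_orthogonal.
  rewrite closure_id in cS.
  suff : [set u | dot v u = 0] h by [].
  rewrite cS => B hB; apply: hclus => //.
  exists k.+1 => // n /= kn; rewrite (dotC ip).
  exact: partial_sum_orth kn Ev.
have hball : nbhs h (ball h e) by apply: nbhsx_ballx.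
have xrange : (x @ \oo) (range x) by exists 0%N => // n _; exists n.
have [y [[n _ <-]]] := hclus _ _ xrange hball.
by rewrite h0 -ball_normE /= sub0r normrN => ?; exists n.
Qed.

(** The domain of [A] is the range of [K]. *)
Lemma expansion_dom u (e : R) : D u -> 0 < e ->
  exists n, `|u - partial_sum P n u| < e.
Proof.
move=> Du e0; have <- := KA.2 u Du; move: (A u - z *: u) => f.
have [->|f0] := eqVneq f 0.
  exists 0%N; rewrite (linear_map0 K_linear).
  by rewrite [partial_sum P 0 _]big_geq// subr0 normr0.
have nf : 0 < `|f| by rewrite normr_gt0.
have [||n] := @expansion_resolvent_ball (`|f|^-1 *: f) (e / `|f|).
- by rewrite normrZ normfV normr_id mulVf// gt_eqF.
- by rewrite divr_gt0.
rewrite (linear_mapZ K_linear) partial_sumZ -scalerBr normrZ normfV normr_id mulrC.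
by rewrite ltr_pM2r ?invr_gt0// => ?; exists n.
Qed.

Hypothesis D_dense : dense D.

(** Approximate [u] by [v] in [D]: the remainder of [u - v] is not longer than
    [u - v]. *)
Lemma expansion_exists u (e : R) : 0 < e ->
  exists n, `|u - partial_sum P n u| < e.
Proof.
move=> e0; have e2 : 0 < e / 2 by rewrite divr_gt0.
have [v [uv Dv]] : ball u (e / 2) `&` D !=set0.
  by apply: D_dense; [exists u; exact: ballxx|exact: ball_open].
have [n vn] := expansion_dom Dv e2; exists n.
rewrite -ball_normE /= in uv.
have -> : u - partial_sum P n u =
    (u - v - partial_sum P n (u - v)) + (v - partial_sum P n v).
  by rewrite partial_sumB opprB [RHS]addrC addrACA [v + _]addrC subrK addKr.
apply: le_lt_trans (ler_normD _ _) _; rewrite (splitr e) ltrD//.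
exact: le_lt_trans (partial_sum_gap_le _ _) uv.
Qed.

Lemma expansion_cvg u : (fun n => `|u - partial_sum P n u|) @ \oo --> (0 : R).
Proof.
apply/cvgrPdist_lt => e e0; have [N hN] := expansion_exists u e0.
exists N => // n /= Nn; rewrite sub0r normrN normr_id.
exact: le_lt_trans (partial_sum_gap_decr _ Nn) hN.
Qed.

End expansion.

(** * The closed quadratic form in terms of the components *)

Section energy.
Context {R : realType} {V : normedModType R} {dot : V -> V -> R}.
Hypothesis ip : inner_product dot.
Context {D : set V} {A : V -> V}.
Hypothesis sA : symmetric_operator dot D A.
Context {m : nat -> R} {P : nat -> V -> V}.
Hypothesis m_lt : forall i j : nat, (i < j)%N -> m i < m j.
Hypothesis m_ge0 : forall k, 0 <= m k.
Local Notation E k := (eigen_subspace D A (m k)).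
Hypothesis PE : forall k, orth_projection dot (E k) (P k).
Hypothesis P_complete :
  forall u, (fun n => `|u - partial_sum P n u|) @ \oo --> (0 : R).
Implicit Types u v w : V.

Lemma dot_expansion_cvg u v :
  (fun n => dot (partial_sum P n u) v) @ \oo --> dot u v.
Proof.
have : (fun n => `|u - partial_sum P n u| * `|v|) @ \oo --> 0 * `|v|.
  by apply: cvgM; [exact: P_complete|exact: cvg_cst].
rewrite mul0r => /cvgrPdist_lt h; apply/cvgrPdist_lt => e /h.
apply: filterS => n; rewrite sub0r normrN ger0_norm ?mulr_ge0//.
move=> he; apply: le_lt_trans he; rewrite -(dotBl ip); exact: norm_dot_le.
Qed.

Lemma parseval u :
  (fun n => \sum_(0 <= k < n) `|P k u| ^+ 2) @ \oo --> `|u| ^+ 2.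
Proof.
rewrite -(dotuu ip).
suff -> : (fun n => \sum_(0 <= k < n) `|P k u| ^+ 2) =
    (fun n => dot (partial_sum P n u) u) by exact: dot_expansion_cvg.
apply/funext => n; rewrite (dot_suml ip).
by apply: eq_bigr => k _; rewrite (dot_component ip PE) (dotuu ip).
Qed.

Definition form_sum (p : nat -> R) (Q : nat -> V -> V) n u : R :=
  \sum_(0 <= k < n) p k * `|Q k u| ^+ 2.

Local Notation q := (form_sum m P).

Let PB := componentB ip sA PE.

Lemma form_sum_nondecreasing u : nondecreasing_seq (q ^~ u).
Proof.
move=> n n' nn'; rewrite /form_sum (big_cat_nat (leq0n n) nn')/= lerDl.
by apply: sumr_ge0 => k _; rewrite mulr_ge0 ?sqr_ge0.
Qed.

(** By symmetry of [A], the truncated form is [<s_n, A u>] with [s_n] the [n]-th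
    partial sum of the expansion of [u]. *)
Lemma form_sum_cvg_dom u : D u -> q ^~ u @ \oo --> dot (A u) u.
Proof.
move=> Du; rewrite (dotC ip).
suff -> : q ^~ u = (fun n => dot (partial_sum P n u) (A u)).
  exact: dot_expansion_cvg.
apply/funext => n; rewrite (dot_suml ip); apply: eq_bigr => k _.
have [DP AP] := component_in PE k u.
by rewrite -(sop_sym sA)// AP (dotZl ip) (dot_component ip PE) (dotuu ip).
Qed.

Lemma form_sum_le_dom n u : D u -> q n u <= dot (A u) u.
Proof.
move=> Du; have cq := form_sum_cvg_dom Du.
rewrite -(cvg_lim _ cq)//; apply: nondecreasing_cvgn_le; last by apply: cvgP cq.
exact: form_sum_nondecreasing.
Qed.

(** The truncation of the square root of [A], applied to [u]. Its squared norm is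
    the truncated form, which thus inherits the triangle inequality. *)
Let form_root n u : V := \sum_(0 <= k < n) Num.sqrt (m k) *: P k u.

Let form_rootB n u v : form_root n (u - v) = form_root n u - form_root n v.
Proof.
rewrite /form_root -sumrB; apply: eq_bigr => k _.
by rewrite PB scalerBr.
Qed.

Let form_root_norm n u : `|form_root n u| ^+ 2 = q n u.
Proof.
rewrite (norm_eigen_sum ip sA m_lt PE); last first.
  move=> k; have [E0 El] := eigenspace_subspace sA (m k).
  by rewrite -[_ *: _]addr0; apply: El => //; exact: component_in.
apply: eq_bigr => k _; rewrite normrZ exprMn real_normK ?num_real//.
by rewrite sqr_sqrtr.
Qed.

Let form_root_lipschitz n u :
  `|form_root n u| <= (\sum_(0 <= k < n) Num.sqrt (m k)) * `|u|.
Proof.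
rewrite mulr_suml; apply: le_trans (ler_norm_sum _ _ _) _.
apply: ler_sum => k _; rewrite normrZ ger0_norm ?sqrtr_ge0//.
rewrite ler_wpM2l ?sqrtr_ge0//.
rewrite -ler_sqr ?nnegrE// -{2}(subrK (P k u) u) (normD_sqr_orth ip).
  by rewrite lerDr sqr_ge0.
by apply: (component_orth PE); exact: (component_in PE).
Qed.

(** The Cauchy condition bounds [form_root n (u_ i - u_ j)] uniformly in [n];
    letting [j] go to infinity at fixed [n] replaces [u_ j] by [u]. *)
Let form_root_approx u (u_ : nat -> V) (e : R) :
  (forall n, D (u_ n)) -> u_ @ \oo --> u ->
  (forall e : R, 0 < e -> exists N, forall i j, (N <= i)%N -> (N <= j)%N ->
      dot (A (u_ i - u_ j)) (u_ i - u_ j) < e) -> 0 < e ->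
  exists N, forall i, (N <= i)%N -> forall n, `|form_root n (u_ i - u)| <= e.
Proof.
move=> Du cu cau e0.
have [N hN] := cau (e ^+ 2) (exprn_gt0 _ e0).
exists N => i Ni n; apply/ler_addgt0Pr => x x0.
(* [C] bounds the norm of [form_root n]; [j] depends on [n], but [N] does not *)
set C := \sum_(0 <= k < n) Num.sqrt (m k).
have C0 : 0 <= C by apply: sumr_ge0 => k _; exact: sqrtr_ge0.
have C1 : 0 < C + 1 by rewrite ltr_wpDl.
have /cvgrPdist_le/(_ (x / (C + 1)))[|N' _ hN'] := cu; first by rewrite divr_gt0.
pose j := maxn N N'.
have -> : u_ i - u = (u_ i - u_ j) - (u - u_ j) by rewrite opprB addrA subrK.
rewrite form_rootB; apply: le_trans (ler_normB _ _) _; apply: lerD.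
  rewrite -ler_sqr ?nnegrE ?(ltW e0)// form_root_norm.
  apply: le_trans (form_sum_le_dom _ _) _; first exact: (domB sA).
  by rewrite ltW// hN// leq_maxl.
apply: le_trans (form_root_lipschitz _ _) _.
have /= := hN' j (leq_maxr _ _); rewrite ler_pdivlMr// => h.
by apply: le_trans h; rewrite mulrC ler_wpM2l// lerDl.
Qed.

(** By [form_root_approx], [|form_root n (u_ i)|] tends to [|form_root n u|] as [i]
    goes to infinity, uniformly in [n]; hence the limits in [n] of the former,
    which are the square roots of the form at [u_ i], tend to the limit in [n] of
    the latter. *)
Lemma form_sum_cvg u (u_ : nat -> V) :
  (forall n, D (u_ n)) -> u_ @ \oo --> u ->
  (forall e : R, 0 < e -> exists N, forall i j, (N <= i)%N -> (N <= j)%N ->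
      dot (A (u_ i - u_ j)) (u_ i - u_ j) < e) ->
  cvgn (q ^~ u) /\
  (fun i => dot (A (u_ i)) (u_ i)) @ \oo --> limn (q ^~ u).
Proof.
move=> Du cu cau.
have qroot v n : `|form_root n v| = Num.sqrt (q n v).
  by rewrite -form_root_norm sqrtr_sqr normr_id.
have dist i n : `| `|form_root n (u_ i)| - `|form_root n u| | <= `|form_root n (u_ i - u)|.
  by rewrite form_rootB; exact: ler_dist_dist.
have nd : nondecreasing_seq (fun n => `|form_root n u|).
  by move=> n n' nn'; rewrite !qroot ler_wsqrtr// form_sum_nondecreasing.
have rcvg : cvgn (fun n => `|form_root n u|).
  apply: nondecreasing_is_cvgn => //.
  have [N hN] := form_root_approx Du cu cau ltr01.
  exists (Num.sqrt (dot (A (u_ N)) (u_ N)) + 1) => _ [n _ <-].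
  rewrite -lerBlDr (@le_trans _ _ `|form_root n (u_ N)|)//.
    rewrite lerBlDr -lerBlDl; apply: le_trans (hN N (leqnn _) n).
    by apply: le_trans (dist _ _); rewrite distrC ler_norm.
  by rewrite qroot ler_wsqrtr// form_sum_le_dom.
set L := limn (fun n => `|form_root n u|).
have sq (f : nat -> R) (l : R) :
    f @ \oo --> l -> (fun n => f n ^+ 2) @ \oo --> l ^+ 2.
  by move=> fl; exact: (cvgM fl fl).
have qL : q ^~ u @ \oo --> L ^+ 2.
  rewrite (_ : q ^~ u = (fun n => `|form_root n u| ^+ 2)); first exact: sq.
  by apply/funext => n; rewrite form_root_norm.
split; first by apply: cvgP qL.
rewrite (cvg_lim _ qL)//.
have form_ge0 i : 0 <= dot (A (u_ i)) (u_ i).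
  by have := form_sum_le_dom 0 (Du i); rewrite /form_sum big_geq.
rewrite (_ : (fun i => _) =
    (fun i => Num.sqrt (dot (A (u_ i)) (u_ i)) ^+ 2)); last first.
  by apply/funext => i; rewrite sqr_sqrtr.
apply: sq; apply/cvgrPdist_le => e e0.
have [N hN] := form_root_approx Du cu cau e0.
exists N => // i /= Ni.
have ci : (fun n => `|form_root n (u_ i)|) @ \oo --> Num.sqrt (dot (A (u_ i)) (u_ i)).
  under eq_fun do rewrite qroot.
  by apply: continuous_cvg (form_sum_cvg_dom (Du i)); exact: sqrt_continuous.
have cd : (fun n => `| `|form_root n u| - `|form_root n (u_ i)| |) @ \oo -->
    `|L - Num.sqrt (dot (A (u_ i)) (u_ i))|.
  by apply: cvg_norm; apply: cvgB.
rewrite -(cvg_lim _ cd)//; apply: limr_le; first by apply: cvgP cd.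
by apply: nearW => n; rewrite distrC (le_trans (dist _ _))// hN.
Qed.

Lemma form_sum_sub_partial_sum n N u : (n <= N)%N ->
  q N (u - partial_sum P n u) = q N u - q n u.
Proof.
move=> nN; rewrite /form_sum !(big_cat_nat (leq0n n) nN)/= addrAC subrr add0r.
rewrite big_nat big1 ?add0r => [|k /= kn].
  rewrite big_nat [RHS]big_nat; apply: eq_bigr => k /andP[nk _].
  rewrite PB (component_partial_sum ip sA m_lt PE).
  by rewrite ltnNge nk/= subr0.
rewrite PB (component_partial_sum ip sA m_lt PE) kn subrr.
by rewrite normr0 expr0n/= mulr0.
Qed.

(** Subtracting a vector of the first [n] eigenspaces does not change the
    components of index at least [n], and the other terms are nonnegative. *)
Lemma form_sum_sub_eigen_sum n N u (v : nat -> V) :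
  (forall k, E k (v k)) -> (n <= N)%N ->
  q N u - q n u <= q N (u - \sum_(0 <= k < n) v k).
Proof.
move=> Ev nN; rewrite /form_sum !(big_cat_nat (leq0n n) nN)/= addrAC subrr add0r.
rewrite [X in X <= _]big_nat [in X in _ <= _ + X]big_nat.
rewrite (eq_bigr (fun k => m k * `|P k (u - \sum_(0 <= k < n) v k)| ^+ 2)).
  by rewrite lerDr; apply: sumr_ge0 => k _; rewrite mulr_ge0 ?sqr_ge0.
move=> k /andP[nk _]; rewrite PB (component_eigen_sum ip sA m_lt PE)//.
by rewrite ltnNge nk/= subr0.
Qed.

(** [u - partial_sum P n u] is orthogonal to the first [n] eigenspaces. *)
Lemma norm_sub_eigen_sum n u (v : nat -> V) : (forall k, E k (v k)) ->
  `|u - partial_sum P n u| ^+ 2 <= `|u - \sum_(0 <= k < n) v k| ^+ 2.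
Proof.
move=> Ev; rewrite -[u in leRHS](subrK (partial_sum P n u)) -addrA.
rewrite [leRHS](normD_sqr_orth ip) ?lerDl ?sqr_ge0//.
have orth (w : nat -> V) : (forall k, E k (w k)) ->
    dot (u - partial_sum P n u) (\sum_(0 <= k < n) w k) = 0.
  move=> Ew; rewrite (dot_sumr ip) big_nat big1// => k /= kn.
  exact: (partial_sum_orth ip sA m_lt PE u kn (Ew k)).
by rewrite (dotBr ip) !orth ?subr0// => k; exact: (component_in PE).
Qed.

End energy.

(** * The inner product of L2 *)

Section L2_inner_product.
Context d (T : measurableType d) (R : realType).
Context (mu : {measure set T -> \bar R}).
Implicit Types u v w : L2 mu.
Local Notation dot := (@L2_dot d T R mu).

Lemma L2_fun_measurable u : measurable_fun setT (L2_fun u).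
Proof. by have := L2_funP u; rewrite inE => /andP[]; rewrite inE. Qed.

Lemma L2_mul_integrable u v :
  mu.-integrable setT (EFin \o (fun x => L2_fun u x * L2_fun v x)).
Proof.
apply/Lfun1_integrable; exact: Lfun2_mul_Lfun1 (L2_funP u) (L2_funP v).
Qed.

Lemma ae_eq_Rintegral (f g : T -> R) :
  measurable_fun setT f -> measurable_fun setT g -> f = g %[ae mu] ->
  \int[mu]_x f x = \int[mu]_x g x.
Proof.
move=> mf mg fg; congr fine; apply: ae_eq_integral => //.
- exact/measurable_EFinP.
- exact/measurable_EFinP.
- by apply: filterS fg => x /= h xT; rewrite h.
Qed.

Lemma L2_inner_product : inner_product dot.
Proof.
split=> [u v|u v w|a u v|u]; last exact: L2_dotuu.
- by apply: eq_Rintegral => x _; rewrite mulrC.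
- rewrite /L2_dot -RintegralD//; [|exact: L2_mul_integrable..].
  apply: ae_eq_Rintegral.
  + by apply: measurable_funM; exact: L2_fun_measurable.
  + by apply: measurable_funD; apply: measurable_funM; exact: L2_fun_measurable.
  + by apply: filterS (L2_funD u v) => x /= h xT; rewrite h// mulrDl.
- rewrite /L2_dot -RintegralZl//; last exact: L2_mul_integrable.
  apply: ae_eq_Rintegral.
  + by apply: measurable_funM; exact: L2_fun_measurable.
  + apply: measurable_funM => //.
    by apply: measurable_funM; exact: L2_fun_measurable.
  + by apply: filterS (L2_funZ a u) => x /= h xT; rewrite h// mulrA.
Qed.

End L2_inner_product.

(** * The form domain and the distances to sums of eigenspaces *)

Section spectral_form.
Context d (T : measurableType d) (R : realType).
Context {mu : {measure set T -> \bar R}} {A : unbounded_operator mu}.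
Context {m : nat -> R}.
Implicit Types u v w : L2 mu.
Local Notation dot := (@L2_dot d T R mu).
Local Notation ip := (L2_inner_product mu).
Local Notation E k := (op_eigenspace A (m k)).
Local Notation P k := (orth_proj (E k)).
Local Notation s n u := (partial_sum (fun k => P k) n u).
Local Notation q n u := (form_sum m (fun k => P k) n u).
Local Notation M := (eigen_sum A m).

Hypothesis sA : self_adjoint A.
Hypothesis cA : compact_resolvent A.
Hypothesis m0 : m 0%N = 0.
Hypothesis m_lt : forall i j : nat, (i < j)%N -> m i < m j.
Hypothesis m_eigenvalue : forall l, op_eigenvalue A l <-> exists k, l = m k.

Lemma self_adjoint_symmetric : symmetric_operator dot (dom A) A.
Proof.
split; first by split; [exact: dom0|exact: dom_linear].
  exact: op_linear.
by move=> u v Du Dv; have /(_ u Du) := (sA.2 v (A v)).2 (conj Dv erefl).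
Qed.

Local Notation syA := self_adjoint_symmetric.

Let m_ge0 k : 0 <= m k.
Proof. by case: k => [|k]; rewrite -m0// ltW// m_lt. Qed.

Lemma orth_proj_eigenspace k : orth_projection dot (E k) (P k).
Proof.
have [z [K [KA K_compact]]] := cA.
have [|Q hQ] := resolvent_orth_projection ip syA KA K_compact (l := m k).
  by apply/m_eigenvalue; exists k.
move=> u.
have : exists p, [set p | E k p /\ forall v, E k v -> dot (u - p) v = 0] p.
  by exists (Q u); exact: hQ.
exact: xgetPex.
Qed.

Local Notation PE := orth_proj_eigenspace.

Lemma eigen_expansion u : (fun n => `|u - s n u|) @ \oo --> (0 : R).
Proof.
have [z [K [KA K_compact]]] := cA.
exact: (expansion_cvg ip syA m_lt PE KA K_compact m_eigenvalue sA.1).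
Qed.

(** Every approximating sequence gives the same limit, namely that of the
    truncated forms at [u]; it is therefore the value picked by [energy]. *)
Lemma form_domain_energy u : form_domain A u ->
  cvgn (fun n => q n u) /\ energy A u = limn (fun n => q n u).
Proof.
have approx (u_ : nat -> L2 mu) : form_approx A u u_ -> cvgn (fun n => q n u) /\
    (fun n => dot (A (u_ n)) (u_ n)) @ \oo --> limn (fun n => q n u).
  move=> [Du cu cau].
  exact: (form_sum_cvg ip syA m_lt m_ge0 PE eigen_expansion Du cu cau).
move=> [u_ au]; have [cq cform] := approx _ au; split=> //.
have : exists e : R, [set e : R | exists2 u_ : nat -> L2 mu, form_approx A u u_ &
    (fun n => dot (A (u_ n)) (u_ n)) @ \oo --> e] e.
  by exists (limn (fun n => q n u)); exists u_.
move=> /(xgetPex 0)[v_ av cv]; have [_ cform'] := approx _ av.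
by apply: (cvg_unique _ cv cform').
Qed.

Lemma form_domain_dom u : dom A u -> form_domain A u.
Proof.
move=> Du; exists (fun=> u); split=> //; first exact: cvg_cst.
move=> e e0; exists 0%N => i j _ _.
by rewrite subrr (dot0r ip).
Qed.

Lemma form_domain_subr u v : form_domain A u -> dom A v -> form_domain A (u - v).
Proof.
move=> [u_ [Du cu cau]] Dv; exists (fun n => u_ n - v); split.
- by move=> n; exact: (domB syA).
- have /cvgrPdist_lt cu' := cu; apply/cvgrPdist_lt => e /cu'; apply: filterS => n.
  by rewrite opprB addrA subrK.
- move=> e /cau[N hN]; exists N => i j Ni Nj.
  by rewrite opprB addrA subrK; exact: hN.
Qed.

Lemma eigen_sumP n u : M n u <-> exists2 v : nat -> L2 mu,
  (forall k, E k (v k)) & u = \sum_(0 <= k < n.+1) v k.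
Proof.
split=> [[v Ev ->]|[v Ev ->]]; last first.
  by exists (fun k => v k) => [k|]; [exact: Ev|rewrite big_mkord].
(* the family on ['I_n.+1] is extended by 0 to all indices *)
exists (fun k => if insub k is Some i then v i else 0) => [k|].
  case: insubP => [i _ <-|_]; first exact: Ev.
  by have [] := eigenspace_subspace syA (m k).
by rewrite big_mkord; apply: eq_bigr => i _; rewrite valK.
Qed.

Lemma eigen_sum_dom n u : M n u -> dom A u.
Proof.
move=> /eigen_sumP[v Ev ->]; apply: big_ind => [|x y Dx Dy|k _].
- exact: dom0.
- by rewrite -[x]scale1r; exact: dom_linear.
- by have [] := Ev k.
Qed.

Lemma partial_sum_in n u : M n (s n.+1 u).
Proof.
apply/eigen_sumP; exists (fun k => P k u) => // k; exact: (component_in PE).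
Qed.

Lemma eigen_sum_mem n u : M n u <-> u = s n.+1 u.
Proof.
split=> [/eigen_sumP[v Ev ->]|->]; last exact: partial_sum_in.
rewrite /partial_sum; apply: eq_big_nat => k /= kn.
by rewrite (component_eigen_sum ip syA m_lt PE)// kn.
Qed.

Lemma inf_attained (S : set R) x : S x -> (forall y, S y -> x <= y) -> inf S = x.
Proof.
move=> Sx lb; apply/eqP; rewrite eq_le; apply/andP; split.
  by apply: ge_inf => //; exists x.
by apply: lb_le_inf => //; exists x.
Qed.

Lemma L2_dist2_eigen_sum n u :
  L2_dist2 u (M n) = `|u| ^+ 2 - \sum_(0 <= k < n.+1) `|P k u| ^+ 2.
Proof.
rewrite -(norm_sub_partial_sum ip syA m_lt PE).
apply: inf_attained; first by exists (s n.+1 u) => //; exact: partial_sum_in.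
move=> _ [Phi /eigen_sumP[v Ev ->] <-].
exact: (norm_sub_eigen_sum ip syA m_lt PE).
Qed.

(** The energy of [u - Phi] is the limit of its truncated forms, each of which is
    minimal when [Phi] is the partial sum. *)
Lemma energy_dist2_eigen_sum n u : form_domain A u ->
  energy_dist2 A u (M n) = energy A u - q n.+1 u.
Proof.
move=> Du; have [cq eu] := form_domain_energy Du.
have shift : (fun N => q N u - q n.+1 u) @ \oo --> energy A u - q n.+1 u.
  by apply: cvgB; [rewrite eu|exact: cvg_cst].
have energyB v : M n v -> cvgn (fun N => q N (u - v)) /\
    energy A (u - v) = limn (fun N => q N (u - v)).
  by move=> /eigen_sum_dom Dv; apply: form_domain_energy; exact: form_domain_subr.
apply: inf_attained.
  exists (s n.+1 u); first exact: partial_sum_in.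
  have [_ ->] := energyB _ (partial_sum_in n u).
  apply: cvg_lim => //; apply: cvg_trans shift; apply: near_eq_cvg.
  exists n.+1 => // N /= nN; apply/esym.
  exact: (form_sum_sub_partial_sum ip syA m_lt PE).
move=> _ [Phi MPhi <-]; have [cPhi ->] := energyB _ MPhi.
rewrite -(cvg_lim _ shift)//; apply: ler_lim => //; first by apply: cvgP shift.
have [v Ev ->] := (eigen_sumP n Phi).1 MPhi.
exists n.+1 => // N /= nN.
exact: (form_sum_sub_eigen_sum ip syA m_lt m_ge0 PE).
Qed.

(** * The remainder of the two inequalities *)

(** The value of [sum_(k >= 4) (m_k - m_3) a_k] obtained from the sums of the two
    expansions by removing their first four terms. *)
Definition remainder u : R :=
  energy A u - m 3%N * `|u| ^+ 2 -
  \sum_(0 <= k < 4) (m k - m 3%N) * `|P k u| ^+ 2.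

Lemma remainder_cvg u : form_domain A u ->
  (fun n => \sum_(4 <= k < n) (m k - m 3%N) * component_norm2 A m k u)
    @ \oo --> remainder u.
Proof.
move=> Du; have [cq eu] := form_domain_energy Du.
have cN : (fun n => \sum_(0 <= k < n) `|P k u| ^+ 2) @ \oo --> `|u| ^+ 2.
  exact: (parseval ip PE eigen_expansion).
have full : (fun n => \sum_(0 <= k < n) (m k - m 3%N) * component_norm2 A m k u -
    \sum_(0 <= k < 4) (m k - m 3%N) * `|P k u| ^+ 2) @ \oo --> remainder u.
  apply: cvgB; last exact: cvg_cst.
  under eq_fun do under eq_bigr do rewrite mulrBl.
  under eq_fun do rewrite sumrB -mulr_sumr.
  apply: cvgB; first by rewrite eu.
  by apply: cvgM; [exact: cvg_cst|exact: cN].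
apply: cvg_trans full; apply: near_eq_cvg; exists 4%N => // n /= n4.
by rewrite (big_cat_nat (leq0n 4) n4)/= addrAC subrr add0r.
Qed.

Let gap_ge0 k : (4 <= k)%N -> 0 < m k - m 3%N.
Proof. by move=> k4; rewrite subr_gt0 m_lt. Qed.

Let tail_le u n : form_domain A u ->
  \sum_(4 <= k < n) (m k - m 3%N) * component_norm2 A m k u <= remainder u.
Proof.
move=> Du; have cr := remainder_cvg Du; rewrite -(cvg_lim _ cr)//.
apply: (nondecreasing_cvgn_le _ (cvgP _ cr)) => i j ij.
have [i4|i4] := leqP 4 i.
  rewrite (big_cat_nat i4 ij)/= lerDl big_nat.
  apply: sumr_ge0 => k /andP[ik _].
  by rewrite mulr_ge0 ?sqr_ge0// ltW// gap_ge0// (leq_trans i4).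
rewrite big_geq ?(ltnW i4)// big_nat; apply: sumr_ge0 => k /andP[k4 _].
by rewrite mulr_ge0 ?sqr_ge0// ltW// gap_ge0.
Qed.

Lemma remainder_ge0 u : form_domain A u -> 0 <= remainder u.
Proof. by move=> /(@tail_le u 0); rewrite big_geq. Qed.

(** All the terms of the series being nonnegative, a zero remainder leaves only
    the first four components of [u]. *)
Lemma remainder_eq0 u : form_domain A u -> remainder u = 0 <-> M 3%N u.
Proof.
move=> Du.
have zero : (forall k, (4 <= k)%N -> P k u = 0) -> remainder u = 0.
  move=> Pu; rewrite -(cvg_lim _ (remainder_cvg Du))//.
  rewrite (_ : (fun n => _) = fun=> 0); first exact: lim_cst.
  apply/funext => n; rewrite big_nat big1// => k /andP[k4 _].
  by rewrite /component_norm2 Pu// normr0 expr0n/= mulr0.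
split=> [r0|/eigen_sum_mem Mu]; last first.
  apply: zero => k k4; rewrite Mu (component_partial_sum ip syA m_lt PE).
  by rewrite ltnNge k4.
have Pu k : (4 <= k)%N -> P k u = 0.
  move=> k4; have := tail_le k.+1 Du; rewrite r0 big_nat_recr//= => le0.
  have t0 : 0 <= \sum_(4 <= i < k) (m i - m 3%N) * component_norm2 A m i u.
    rewrite big_nat; apply: sumr_ge0 => i /andP[i4 _].
    by rewrite mulr_ge0 ?sqr_ge0// ltW// gap_ge0.
  have : (m k - m 3%N) * component_norm2 A m k u <= 0.
    by apply: le_trans le0; rewrite lerDr.
  rewrite pmulr_rle0 ?gap_ge0// => Pk.
  have /eqP : component_norm2 A m k u == 0 by rewrite eq_le Pk sqr_ge0.
  by move/eqP; rewrite sqrf_eq0 normr_eq0 => /eqP.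
apply/eigen_sum_mem/eqP; rewrite -subr_eq0 -normr_eq0; apply/eqP.
apply: (cvg_unique _ _ (eigen_expansion u)) => //.
apply: cvg_near_cst; exists 4%N => // n /= n4.
have tail0 : \sum_(4 <= k < n) P k u = 0.
  by rewrite big_nat big1// => k /andP[k4 _]; exact: Pu.
by rewrite /partial_sum (big_cat_nat (leq0n 4) n4)/= tail0 addr0.
Qed.

Let variance_eq u : Defs.variance A m u = `|u| ^+ 2 - `|P 0%N u| ^+ 2.
Proof.
have := norm_sub_partial_sum ip syA m_lt PE 1 u.
by rewrite /partial_sum !big_nat1.
Qed.

Let sum2 (F : nat -> R) : \sum_(0 <= k < 2) F k = F 0%N + F 1%N.
Proof. by rewrite !big_nat_recr//= big_geq// add0r. Qed.

Let sum3 (F : nat -> R) : \sum_(0 <= k < 3) F k = F 0%N + F 1%N + F 2%N.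
Proof. by rewrite big_nat_recr//= sum2. Qed.

Let sum4 (F : nat -> R) : \sum_(0 <= k < 4) F k = F 0%N + F 1%N + F 2%N + F 3%N.
Proof. by rewrite big_nat_recr//= sum3. Qed.

Lemma L2_remainder u : form_domain A u ->
  deficit A m u - (m 2%N - m 1%N) * L2_dist2 u (M 1%N) -
    (m 3%N - m 2%N) * L2_dist2 u (M 2%N) = remainder u.
Proof.
move=> Du; rewrite /deficit variance_eq !L2_dist2_eigen_sum /remainder.
rewrite sum2 sum3 sum4 m0.
move: (energy A u) (`|u|) (`|P 0%N u|) (`|P 1%N u|) (`|P 2%N u|) (`|P 3%N u|).
by move=> *; ring.
Qed.

Lemma energy_remainder u : form_domain A u ->
  deficit A m u - (1 - m 1%N / m 2%N) * energy_dist2 A u (M 1%N) -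
    m 1%N * ((m 2%N)^-1 - (m 3%N)^-1) * energy_dist2 A u (M 2%N) =
  m 1%N / m 3%N * remainder u.
Proof.
move=> Du; rewrite /deficit variance_eq !energy_dist2_eigen_sum// /remainder.
rewrite /form_sum sum2 sum3 sum4 m0.
have p2 : m 2%N != 0 by rewrite gt_eqF// -m0 m_lt.
have p3 : m 3%N != 0 by rewrite gt_eqF// -m0 m_lt.
move: (energy A u) (`|u|) (`|P 0%N u|) (`|P 1%N u|) (`|P 2%N u|) (`|P 3%N u|).
by move=> *; field; rewrite p2 p3.
Qed.

(** An eigenvector for [m 3] is in [M 3] and is orthogonal to [M 2]. *)
Lemma nontrivial_equality_case : exists2 u, form_domain A u /\ M 3%N u &
  0 < L2_dist2 u (M 2%N) /\ 0 < energy_dist2 A u (M 2%N).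
Proof.
have [u Eu u0] : op_eigenvalue A (m 3%N) by apply/m_eigenvalue; exists 3%N.
have Du : dom A u by have [] := Eu.
have FDu := form_domain_dom Du.
have Pu : P 3%N u = u by exact: (component_id ip syA PE).
have Pu0 k : (k != 3)%N -> P k u = 0.
  by move=> k3; apply: (component_other ip syA m_lt PE _ Eu); rewrite eq_sym.
have nu : 0 < `|u| ^+ 2 by rewrite exprn_gt0// normr_gt0.
exists u; split=> //.
- apply/eigen_sum_mem; rewrite /partial_sum big_nat_recr//= Pu.
  by rewrite big_nat big1 ?add0r// => k /andP[_ k3]; rewrite Pu0// ltn_eqF.
- by rewrite L2_dist2_eigen_sum sum3 !Pu0// !normr0 expr0n/= !addr0 subr0.
- rewrite energy_dist2_eigen_sum// /form_sum sum3 !Pu0// !normr0 expr0n/= !mulr0.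
  rewrite !addr0 subr0; have [_ ->] := form_domain_energy FDu.
  rewrite (cvg_lim _ (form_sum_cvg_dom ip syA PE eigen_expansion Du))//.
  by rewrite Eu.2 (dotZl ip) (dotuu ip) mulr_gt0// -m0 m_lt.
Qed.

End spectral_form.

Arguments remainder {d T R mu} A m u.

Theorem theorem2p3 (d : measure_display) (X : measurableType d) (R : realType)
    (mu : {finite_measure set X -> \bar R})
    (A : unbounded_operator mu) (m : nat -> R) :
  self_adjoint A -> nonnegative A -> compact_resolvent A ->
  m 0%N = 0 -> (forall i j : nat, (i < j)%N -> m i < m j) ->
  m @ \oo --> +oo ->
  (forall l : R, op_eigenvalue A l <-> exists k : nat, l = m k) ->
  op_eigenspace A (m 0%N) = constant_functions (mu := mu) ->
  let D := form_domain A in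
  let M := eigen_sum A m in
  let lhs1 u := deficit A m u - (m 2%N - m 1%N) * L2_dist2 u (M 1%N) in
  let lhs2 u := deficit A m u - (1 - m 1%N / m 2%N) * energy_dist2 A u (M 1%N) in
  let c1 := m 3%N - m 2%N in
  let c2 := m 1%N * ((m 2%N)^-1 - (m 3%N)^-1) in
  let tail u n := \sum_(4 <= k < n) (m k - m 3%N) * component_norm2 A m k u in
  (forall u, D u -> lhs1 u >= c1 * L2_dist2 u (M 2%N)) /\
  (forall u, D u -> lhs2 u >= c2 * energy_dist2 A u (M 2%N)) /\
  (forall c, (forall u, D u -> lhs1 u >= c * L2_dist2 u (M 2%N)) -> c <= c1) /\
  (forall c, (forall u, D u -> lhs2 u >= c * energy_dist2 A u (M 2%N)) -> c <= c2) /\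
  (exists u, [/\ D u, L2_dist2 u (M 2%N) != 0 & lhs1 u = c1 * L2_dist2 u (M 2%N)]) /\
  (exists u, [/\ D u, energy_dist2 A u (M 2%N) != 0 &
                 lhs2 u = c2 * energy_dist2 A u (M 2%N)]) /\
  (forall u, D u -> (lhs1 u = c1 * L2_dist2 u (M 2%N) <-> M 3%N u)) /\
  (forall u, D u -> (lhs2 u = c2 * energy_dist2 A u (M 2%N) <-> M 3%N u)) /\
  (forall u, D u -> [/\ cvgn (tail u),
     lhs1 u - c1 * L2_dist2 u (M 2%N) = limn (tail u) &
     lhs2 u - c2 * energy_dist2 A u (M 2%N) = m 1%N / m 3%N * limn (tail u)]).
Proof.
move=> sA _ cA m0 m_lt _ m_eigenvalue _ D M lhs1 lhs2 c1 c2 tail.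
have r1 u : D u -> lhs1 u - c1 * L2_dist2 u (M 2%N) = remainder A m u.
  exact: (L2_remainder sA cA m0 m_lt m_eigenvalue).
have r2 u : D u ->
    lhs2 u - c2 * energy_dist2 A u (M 2%N) = m 1%N / m 3%N * remainder A m u.
  exact: (energy_remainder sA cA m0 m_lt m_eigenvalue).
have r_ge0 u : D u -> 0 <= remainder A m u.
  exact: (remainder_ge0 sA cA m0 m_lt m_eigenvalue).
have r_eq0 u : D u -> remainder A m u = 0 <-> M 3%N u.
  exact: (remainder_eq0 sA cA m0 m_lt m_eigenvalue).
have r_cvg u : D u -> tail u @ \oo --> remainder A m u.
  exact: (remainder_cvg sA cA m0 m_lt m_eigenvalue).
have [e [De Me] [e1 e2]] := nontrivial_equality_case sA cA m0 m_lt m_eigenvalue.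
have m13 : 0 < m 1%N / m 3%N by rewrite divr_gt0// -m0 m_lt.
have eq1 u : D u -> lhs1 u = c1 * L2_dist2 u (M 2%N) <-> M 3%N u.
  move=> Du; rewrite -(r_eq0 u Du) -(r1 u Du).
  by split=> [->|/eqP]; [rewrite subrr|rewrite subr_eq0 => /eqP].
have eq2 u : D u -> lhs2 u = c2 * energy_dist2 A u (M 2%N) <-> M 3%N u.
  move=> Du; rewrite -(r_eq0 u Du); split=> [h|h].
    have /esym/eqP := r2 u Du.
    by rewrite h subrr mulf_eq0 (gt_eqF m13)/= => /eqP.
  by apply/eqP; rewrite -subr_eq0 (r2 u Du) h mulr0.
split; first by move=> u Du; rewrite -subr_ge0 r1// r_ge0.
split; first by move=> u Du; rewrite -subr_ge0 r2// mulr_ge0 ?(ltW m13)// r_ge0.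
split; first by move=> c /(_ e De); rewrite ((eq1 e De).2 Me) ler_pM2r.
split; first by move=> c /(_ e De); rewrite ((eq2 e De).2 Me) ler_pM2r.
split; first by exists e; split=> //; [rewrite gt_eqF|apply/eq1].
split; first by exists e; split=> //; [rewrite gt_eqF|apply/eq2].
do 2 split=> //.
move=> u Du; have cr := r_cvg u Du.
split; first by apply: cvgP cr.
- by rewrite (cvg_lim _ cr)// r1.
- by rewrite (cvg_lim _ cr)// r2.
Qed.
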